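(* Let $M(n)=\max_{\pi\in S_n}\mathrm{cost}(\pi)$. Then $M(n)\ge \lceil \log_2 n\rceil$ for each $n\ge 2$.
   Context: Permutations are written in one-line notation; $S_n$ is the set of permutations of $[n]=\{1,\dots,n\}$, $id_n = 12\cdots n$, and $\varepsilon$ is the empty sequence. The device $\mathbb{Q}_{\mathrm{cuts}}^{\prime}$ processes configurations $(s_{inp},s_{dev},s_{out})$ of three sequences (input, content of the device, output), starting from $(\pi,\varepsilon,\varepsilon)$ and ending at $(\varepsilon,\varepsilon,\pi')$, using freely chosen operations: push (move the first element of the input to the end of $s_{dev}$); pop (move the first element of $s_{dev}$ to the end of the output); cut/shuffle (if $s_{dev}=s_1\cdots s_m$ with $m\ge2$, choose $k\in\{2,\dots,m\}$ and replace the content by $s_k s_{k+1}\cdots s_m s_1\cdots s_{k-1}$), where immediately after each cut the entire content of the device must be unloaded, i.e. appended in order to the output, leaving the device empty. Such a run is called an iteration, and $\mathbb{Q}_{\mathrm{cuts}}^{\prime}(\pi)$ denotes the set of all possible outputs $\pi'$ on input $\pi$. $(\mathbb{Q}_{\mathrm{cuts}}^{\prime})^{m}(\pi)$ is the set of permutations obtainable from $\pi$ by $m$ successive iterations (the output of each being the input of the next), with $(\mathbb{Q}_{\mathrm{cuts}}^{\prime})^{0}(\pi)=\{\pi\}$. Finally, $\mathrm{cost}(\pi)=\min\{m\ge 0 : id_n\in(\mathbb{Q}_{\mathrm{cuts}}^{\prime})^{m}(\pi)\}$ for $\pi\in S_n$; in particular $\mathrm{cost}(id_n)=0$. *)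

(* Defs.v *)
From mathcomp Require Import all_boot all_fingroup.
From mathcomp Require Import boolp classical_sets.
From Stdlib Require Import Relation_Operators.

Set Implicit Arguments.
Unset Strict Implicit.
Unset Printing Implicit Defensive.

Local Open Scope classical_set_scope.

Record config := Config {
  s_inp : seq nat;
  s_dev : seq nat;
  s_out : seq nat }.

(* [cut k [:: s_1; ...; s_m]] is s_k ... s_m s_1 ... s_(k-1); positions are
   numbered from 1. *)
Definition cut (k : nat) (s : seq nat) : seq nat :=
  drop k.-1 s ++ take k.-1 s.

(* Since the device must be unloaded immediately after a cut, a cut and the
   unloading that follows it form a single transition. The condition
   2 <= k <= size dev already forces size dev >= 2. *)
Inductive device_step : config -> config -> Prop :=
| Push x inp dev out :
    device_step (Config (x :: inp) dev out) (Config inp (rcons dev x) out)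
| Pop x inp dev out :
    device_step (Config inp (x :: dev) out) (Config inp dev (rcons out x))
| CutUnload k inp dev out :
    2 <= k <= size dev ->
    device_step (Config inp dev out) (Config inp [::] (out ++ cut k dev)).

Definition device_run : config -> config -> Prop :=
  clos_refl_trans_1n config device_step.

Definition Qcuts (s : seq nat) : set (seq nat) :=
  [set t | device_run (Config s [::] [::]) (Config [::] [::] t)].

Fixpoint Qcuts_iter (m : nat) (s : seq nat) : set (seq nat) :=
  if m is m'.+1 then \bigcup_(t in Qcuts_iter m' s) Qcuts t else [set s].

(* 'I_n is {0, ..., n-1}, hence the shift to values in {1, ..., n}. *)
Definition one_line (n : nat) (p : 'S_n) : seq nat :=
  [seq (p i).+1 | i <- enum 'I_n].

Definition id_word (n : nat) : seq nat := iota 1 n.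

Lemma one_line_id (n : nat) : one_line (1%g : 'S_n) = id_word n.
Proof.
rewrite /one_line /id_word (eq_map (g := fun i : 'I_n => (val i).+1)); last first.
  by move=> i; rewrite perm1.
by rewrite (map_comp S val) val_enum_ord -[1]addn0 iotaDl; apply: eq_map.
Qed.

Lemma one_line_perm (n : nat) (p : 'S_n) : perm_eq (one_line p) (id_word n).
Proof.
rewrite -one_line_id /one_line.
rewrite (map_comp (fun i : 'I_n => i.+1) p).
rewrite [X in perm_eq _ X](map_comp (fun i : 'I_n => i.+1) (1%g : 'S_n)).
apply/perm_map/uniq_perm; rewrite ?(map_inj_uniq perm_inj) ?enum_uniq //.
have all_im (q : 'S_n) i : i \in map q (enum 'I_n).
  by apply/mapP; exists (q^-1%g i); rewrite ?mem_enum ?permKV.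
by move=> i; rewrite !all_im.
Qed.

(* Every word can be sorted by finitely many iterations, so that the minimum
   defining [cost] is taken over a nonempty set. *)
Definition reaches (s t : seq nat) : Prop := exists m, Qcuts_iter m s t.

Lemma device_run_trans c1 c2 c3 :
  device_run c1 c2 -> device_run c2 c3 -> device_run c1 c3.
Proof. by elim=> // x y z xy _ IH /IH; apply: rt1n_trans. Qed.

Lemma device_run_pass a inp out :
  device_run (Config (a ++ inp) [::] out) (Config inp [::] (out ++ a)).
Proof.
elim: a out => [|x a IH] out /=; first by rewrite cats0; apply: rt1n_refl.
apply: rt1n_trans (Push _ _ _ _) _; apply: rt1n_trans (Pop _ _ _ _) _.
by rewrite -cat_rcons; apply: IH.
Qed.

Lemma Qcuts_swap a x y b : Qcuts (a ++ x :: y :: b) (a ++ y :: x :: b).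
Proof.
apply: device_run_trans (device_run_pass _ _ _) _.
apply: rt1n_trans (Push _ _ _ _) _; apply: rt1n_trans (Push _ _ _ _) _.
apply: rt1n_trans (CutUnload (k := 2) _ _ _) _ => //=.
have := device_run_pass b [::] (a ++ [:: y; x]).
by rewrite cats0 -catA.
Qed.

Lemma reaches_refl s : reaches s s.
Proof. by exists 0. Qed.

Lemma reaches_trans s t u : reaches s t -> reaches t u -> reaches s u.
Proof.
move=> [m st] [k]; elim: k u => [|k IH] u /= => [->|[v /IH [l sv] vu]].
  by exists m.
by exists l.+1, v.
Qed.

Lemma reaches_insert a x t : sorted leq t ->
  exists u, [/\ sorted leq u, perm_eq (x :: t) u & reaches (a ++ x :: t) (a ++ u)].
Proof.
elim: t a => [|y t IH] a yt; first by exists [:: x]; split => //; apply: reaches_refl.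
have [le_xy|/ltnW le_yx] := leqP x y.
  exists [:: x, y & t]; split; rewrite //= ?le_xy //; exact: reaches_refl.
have [u [su pu ru]] := IH (rcons a y) (path_sorted yt).
exists (y :: u); split.
- rewrite /= path_sortedE; last exact: leq_trans.
  rewrite su andbT -(perm_all _ pu) /= le_yx.
  by apply: order_path_min yt; apply: leq_trans.
- rewrite -(perm_cons y) in pu; apply: perm_trans pu.
  by apply/seq.permP => b /=; rewrite addnCA.
- apply: (@reaches_trans _ (a ++ y :: x :: t)); last by rewrite -!(cat_rcons y).
  by exists 1, (a ++ x :: y :: t) => //; apply: Qcuts_swap.
Qed.

Lemma reaches_sorted a s :
  exists u, [/\ sorted leq u, perm_eq s u & reaches (a ++ s) (a ++ u)].
Proof.
elim: s a => [|x s IH] a; first by exists [::]; split => //; apply: reaches_refl.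
have [t [st pt rt]] := IH (rcons a x).
have [u [su pu ru]] := reaches_insert a x st.
exists u; split => //; first by apply: perm_trans pu; rewrite perm_cons.
by apply: reaches_trans ru; rewrite -!(cat_rcons x).
Qed.

Lemma cost_exists (n : nat) (p : 'S_n) :
  exists m, `[< Qcuts_iter m (one_line p) (id_word n) >].
Proof.
have [u [su pu [m ru]]] := reaches_sorted [::] (one_line p).
exists m; apply/asboolP; suff <- : u = id_word n by [].
apply: (sorted_eq leq_trans anti_leq su); first exact: iota_sorted.
by apply: perm_trans (one_line_perm p); rewrite perm_sym.
Qed.

Definition cost (n : nat) (p : 'S_n) : nat := ex_minn (cost_exists p).

Definition max_cost (n : nat) : nat := \max_(p : 'S_n) cost p.

(* Main.v *)
Require Import Defs.
From mathcomp Require Import all_boot.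
From mathcomp Require Import all_fingroup.
From mathcomp Require Import boolp.
From mathcomp Require Import zify.

(** The decreasing permutation [n ... 2 1] costs at least [log_2 n].  What is
    in the device is always a factor of the input, so an iteration splits the
    input into factors, passes some of them unchanged and turns the others from
    [bc] into [cb].  Given any subsequence [t] of the input, drop from every
    factor [bc] the part, [b] or [c], that carries fewer letters of [t]: the
    remaining letters of [t], at least half of them, keep their order
    ([Qcuts_half_subseq]).  After [m] iterations, at least [size t / 2 ^ m]
    letters of [t] are thus still in their original order
    ([Qcuts_iter_subseq]).  Take for [t] the whole decreasing word: if the
    output is increasing, the surviving letters are both increasing and
    decreasing, so at most one survives, and [n <= 2 ^ m]. *)

Lemma subseq_catE (T : eqType) (t a b : seq T) :
  subseq t (a ++ b) ->
  exists t1 t2, [/\ t = t1 ++ t2, subseq t1 a & subseq t2 b].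
Proof.
move=> /subseqP[m sm ->].
have sa : size (take (size a) m) = size a.
  by rewrite size_takel // sm size_cat leq_addr.
exists (mask (take (size a) m) a), (mask (drop (size a) m) b).
by rewrite -mask_cat // cat_take_drop !mask_subseq.
Qed.

Lemma cut_half_subseq (k : nat) (s t : seq nat) :
  subseq t s ->
  exists u, [/\ subseq u t, subseq u (cut k s) & size t <= 2 * size u].
Proof.
rewrite -{1}(cat_take_drop k.-1 s) => /subseq_catE[t1 [t2 [-> st1 st2]]].
have [le12|/ltnW le21] := leqP (size t1) (size t2).
- exists t2; split; first exact: suffix_subseq.
    exact: subseq_trans st2 (prefix_subseq _ _).
  by rewrite size_cat mul2n -addnn leq_add2r.
- exists t1; split; first exact: prefix_subseq.
    exact: subseq_trans st1 (suffix_subseq _ _).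
  by rewrite size_cat mul2n -addnn leq_add2l.
Qed.

(** Generalizes [Qcuts_half_subseq] to runs from an arbitrary configuration, as
    induction on the run requires.  Since the device is a queue, [dev ++ inp]
    is what a run without further cuts appends to the output, hence the word
    from which [t] is taken; a push does not change it. *)
Lemma device_run_half_subseq (c d : config) :
  device_run c d -> s_inp d = [::] -> s_dev d = [::] ->
  exists2 v, s_out d = s_out c ++ v &
    forall t, subseq t (s_dev c ++ s_inp c) ->
    exists u, [/\ subseq u t, subseq u v & size t <= 2 * size u].
Proof.
elim=> {c d} [[inp dev out] /= -> ->|c c' d cc' _ IH inp0 dev0].
  by exists [::] => [|t /eqP->]; [rewrite cats0 | exists [::]].
have {IH inp0 dev0} [v] := IH inp0 dev0.
case: cc' => [x inp dev out|x inp dev out|k inp dev out _] /= -> IH.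
- by exists v => // t; rewrite -cat_rcons; apply: IH.
- exists (x :: v) => [|t]; first by rewrite cat_rcons.
  move=> /(@subseq_catE _ _ [:: x])[t1 [t2 [-> st1 /IH[u [ut uv le_u]]]]].
  exists (t1 ++ u); rewrite -[x :: v]cat1s !cat_subseq //.
  by split=> //; rewrite !size_cat mulnDr leq_add // leq_pmull.
- exists (cut k dev ++ v) => [|t]; first by rewrite catA.
  move=> /subseq_catE[t1 [t2 [-> /cut_half_subseq st1 /IH[u [ut uv le_u]]]]].
  have [u1 [ut1 uv1 le_u1]] := st1 k.
  exists (u1 ++ u); rewrite !cat_subseq //.
  by split=> //; rewrite !size_cat mulnDr leq_add.
Qed.

Lemma Qcuts_half_subseq (s w t : seq nat) :
  Qcuts s w -> subseq t s ->
  exists u, [/\ subseq u t, subseq u w & size t <= 2 * size u].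
Proof.
by move=> /device_run_half_subseq[] //= v -> half_v /half_v.
Qed.

Lemma Qcuts_iter_subseq (m : nat) (s w t : seq nat) :
  Qcuts_iter m s w -> subseq t s ->
  exists u, [/\ subseq u t, subseq u w & size t <= 2 ^ m * size u].
Proof.
elim: m w => [|m IH] w /= => [-> st|[v /IH sv vw] /sv[u [ut uv le_u]]].
  by exists t; rewrite mul1n.
have [u' [uu' u'w le_u']] := Qcuts_half_subseq _ _ _ vw uv.
exists u'; split=> //; first exact: subseq_trans ut.
by apply: leq_trans le_u _; rewrite expnSr -mulnA leq_mul2l le_u' orbT.
Qed.

Lemma sorted_ltn_gtn_size (u : seq nat) :
  sorted ltn u -> sorted gtn u -> size u <= 1.
Proof. by case: u => [|x [|y u]] //= /andP[xy _] /andP[/ltn_geF]; rewrite ltnW. Qed.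

Lemma Qcuts_iter_gtn_size (m : nat) (s w : seq nat) :
  sorted gtn s -> sorted ltn w -> Qcuts_iter m s w -> size s <= 2 ^ m.
Proof.
move=> dec_s inc_w /Qcuts_iter_subseq/(_ (subseq_refl s))[u [us uw le_s]].
have u1 : size u <= 1.
  apply: sorted_ltn_gtn_size; first exact: subseq_sorted ltn_trans _ _ uw inc_w.
  by apply: subseq_sorted us dec_s => x y z /= yx xz; apply: ltn_trans xz yx.
by apply: leq_trans le_s _; rewrite -[leqRHS]muln1 leq_mul2l u1 orbT.
Qed.

Lemma one_line_rev_sorted (n : nat) :
  sorted gtn (one_line (perm (@rev_ord_inj n))).
Proof.
have : sorted ltn (map val (enum 'I_n)).
  by rewrite val_enum_ord iota_ltn_sorted.
rewrite /one_line !sorted_map; apply: sub_sorted => i j /= ij.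
by rewrite !permE /=; have := ltn_ord j; lia.
Qed.

Theorem theorem4p6 (n : nat) (hn : 2 <= n) : up_log 2 n <= max_cost n.
Proof.
pose p := perm (@rev_ord_inj n).
apply: (@leq_trans (cost p)); last exact: (leq_bigmax (F := @cost n)).
rewrite /cost; case: ex_minnP => m /asboolP sorts_p _.
apply: up_log_min => //.
have size_p : size (one_line p) = n by rewrite size_map size_enum_ord.
rewrite -[X in X <= _]size_p.
apply: Qcuts_iter_gtn_size _ _ sorts_p; first exact: one_line_rev_sorted.
exact: iota_ltn_sorted.
Qed.
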